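(* Let $V$ be a non-singular ordered vector space and let $S$ be a commutative monoid (under composition) of positive linear maps $V\to V$. For every $v\in V$ with $v\geq 0$, $v\neq 0$, whose orbit $Sv=\{Tv: T\in S\}$ is order-bounded, there is a positive linear functional $J$ on the orbit ideal $V_{Sv}$ and a monoid homomorphism $t\colon S\to[0,1]$ such that $$J(Tu)=t(T)\,J(u)\quad\text{for all } T\in S \text{ and all } u\in V_{Sv},\qquad\text{and}\qquad J(v)=1.$$
   Context: Vector spaces are over $\mathbf{R}$. An ordered vector space is a real vector space $V$ with a partial order compatible with the linear structure (translation-invariant and invariant under multiplication by non-negative scalars); $V^+=\{v\in V: v\geq 0\}$. No topology on $V$ is assumed. A linear map $T\colon V\to V$ is positive if $T(V^+)\subseteq V^+$; a linear functional on a linear subspace of $V$ (with the induced order) is positive if it takes non-negative values on the elements $\geq 0$ of that subspace. A monoid of linear maps $V\to V$ is a set of such maps closed under composition and containing the identity. The interval $[0,1]$ is regarded as a monoid under multiplication. $V$ is non-singular if for every $v\in V$ with $v\geq 0$, $v\neq 0$, there exists a positive linear functional on $V$ which is non-zero on $v$. A subset of $V$ is order-bounded here if it admits some upper bound in $V$, i.e. there is $w\in V$ with $a\leq w$ for all $a$ in the subset. The orbit ideal $V_{Sv}$ is the smallest vector subspace of $V$ that contains the orbit $Sv$ and is closed under order intervals (if $x\leq y\leq z$ with $x,z$ in the subspace, then $y$ is in the subspace). Equivalently, it consists of the $u\in V$ for which there are $a_1,\dots,a_q\in Sv$ with $\pm u\leq a_1+\cdots+a_q$; every $T\in S$ maps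 it to itself. *)

(* Defs.v *)
From HB Require Import structures.
From mathcomp Require Import all_boot all_order all_algebra.
From mathcomp Require Import boolp classical_sets reals.

Set Implicit Arguments.
Unset Strict Implicit.
Unset Printing Implicit Defensive.

Import Order.TTheory GRing.Theory Num.Theory.

Local Open Scope classical_set_scope.
Local Open Scope ring_scope.

HB.mixin Record Lmodule_isOrdered (R : numDomainType) V
    of GRing.Lmodule R V & Num.POrderedZmodule V := {
  olmod_lerD2r : forall w u v : V, u <= v -> u + w <= v + w;
  olmod_lerZ2l : forall (a : R) (u v : V), 0 <= a -> u <= v -> a *: u <= a *: v
}.

#[short(type="orderedLmodType")]
HB.structure Definition OrderedLmodule (R : numDomainType) :=
  { V of GRing.Lmodule R V & Num.POrderedZmodule V & Lmodule_isOrdered R V }.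

Section OrderedVectorSpace.
Context {R : realType} {V : orderedLmodType R}.
Implicit Types (W : set V) (S : set {linear V -> V}) (u v x y z : V).

Definition positive_map (T : V -> V) := forall u, 0 <= u -> 0 <= T u.

Definition positive_on W (J : V -> R) := forall u, W u -> 0 <= u -> 0 <= J u.

(* A functional on the subspace W is represented by a total function V -> R
   of which only the values on W matter. *)
Definition linear_on W (J : V -> R) :=
  forall (a : R) u v, W u -> W v -> J (a *: u + v) = a * J u + J v.

(* The monoid law is composition; commutativity is stated pointwise. *)
Definition commutative_monoid S :=
  [/\ S idfun,
      forall T1 T2, S T1 -> S T2 -> S (T1 \o T2)
    & forall T1 T2, S T1 -> S T2 -> T1 \o T2 =1 T2 \o T1].

Definition operator_orbit S v : set V := [set T v | T in S].

Definition interval_closed W :=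
  forall x y z, W x -> W z -> x <= y -> y <= z -> W y.

Definition orbit_ideal S v : set V :=
  smallest [set W : set V | submod_closed [in W] /\ interval_closed W]
           (operator_orbit S v).

(* t matters only on S. *)
Definition unit_interval_morphism S (t : {linear V -> V} -> R) :=
  [/\ forall T, S T -> 0 <= t T <= 1,
      t idfun = 1
    & forall T1 T2, S T1 -> S T2 -> t (T1 \o T2) = t T1 * t T2].

End OrderedVectorSpace.

Definition non_singular (R : realType) (V : orderedLmodType R) :=
  forall v : V, 0 <= v -> v != 0 ->
  exists f : {scalar V}, positive_on setT f /\ f v != 0.

(* Main.v *)
Require Import Defs.
From HB Require Import structures.
From mathcomp Require Import all_boot all_order all_algebra.
From mathcomp Require Import lra ring.
From mathcomp Require Import boolp classical_sets reals.

Import Order.TTheory GRing.Theory Num.Theory.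
Local Open Scope classical_set_scope.
Local Open Scope ring_scope.

(** Let P be a convex cone of V that contains the positive elements and is
stable under S, and write x <=_P y for P (y - x).  An operator
b = sum_i c_i T_i with c_i >= 0 and T_i in S has mass m = sum_i c_i.  The proof
rests on one condition on P: an inequality v <=_P b v forces the mass of b to
be at least 1.  It says that v stays away from 0 for the gauge
x |-> inf { mass of b | x <=_P b v }, and it survives unions of chains, so that
maximal cones with this property exist as soon as there is one such cone.

The cone of positive elements is one ([positive_cone_admissible]): a positive
functional f with f v > 0, which non-singularity provides, is bounded on the
orbit, and v <= b v gives sup f(Sv) <= m sup f(Sv).

A maximal cone P then has two properties.

- It contains p - T p whenever it contains p, for p in the orbit ideal
  ([maximal_excessive]).  Otherwise v <=_P b v - q + T q with m < 1 and q in P.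
  Applying R = sum_(i <= n) r^(n-i) T^i, with r slightly larger than 1,
  turns R (T q - q) into (r - 1) R q + T^(n+1) q, up to a term of the good sign.
  Since q <=_P e v for some operator e, and r^n v <=_P R v, this is bounded by
  an operator of small mass applied to R v.  Hence R v <=_P b' (R v) for some b'
  of mass less than 1, and iterating b' contradicts the condition.  In
  particular T v <=_P v, and v is an order unit of the orbit ideal for <=_P.

- It is total on the orbit ideal ([maximal_total]).  If neither x nor - x is in
  P, then maximality yields operators a, a' and constants d, d' > 0 with
  a x <=_P - d v and d' v <=_P a' x.  Since a and a' commute, comparing a' a x
  with a a' x gives a v <=_P 0; as v is an order unit, a x is then >=_P 0,
  which contradicts a x <=_P - d v.

So every x in the orbit ideal lies within an infinitesimal of exactly one
multiple J x *: v of the order unit.  Uniqueness of this multiple makes J linear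
and positive with J v = 1.  The maps in S preserve infinitesimals, so T x is
infinitesimally close to J x *: T v, that is J (T x) = J (T v) J x, and
t T = J (T v) is the desired character. *)

(** * Powers of a real below one *)

Lemma exists_expr_lt1 (R : realType) (m K : R) :
  0 <= m -> m < 1 -> exists n, m ^+ n * K < 1.
Proof.
rewrite le_eqVlt => /orP[/eqP<-|m0] m1.
  by exists 1%N; rewrite expr1 mul0r.
have bernoulli n : 1 + n%:R * (m^-1 - 1) <= m^-1 ^+ n.
  elim: n => [|n IH]; first by rewrite mul0r addr0 expr0.
  have d0 : 0 < m^-1 - 1 by rewrite subr_gt0 invf_gt1.
  have n0 : 0 <= n%:R :> R by exact: ler0n.
  rewrite exprS -natr1.
  apply: (@le_trans _ _ (m^-1 * (1 + n%:R * (m^-1 - 1)))); last first.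
    by rewrite ler_pM2l // invr_gt0.
  have -> : m^-1 * (1 + n%:R * (m^-1 - 1))
      = 1 + (n%:R + 1) * (m^-1 - 1) + n%:R * (m^-1 - 1) ^+ 2 by ring.
  by rewrite lerDl mulr_ge0 // exprn_ge0 // ltW.
have d0 : 0 < m^-1 - 1 by rewrite subr_gt0 invf_gt1.
have [n Kn] : exists n, K < n%:R * (m^-1 - 1).
  exists (Num.bound (`|K| / (m^-1 - 1))).
  rewrite -ltr_pdivrMr //.
  apply: le_lt_trans (archi_boundP _); last by rewrite divr_ge0 // ltW.
  by rewrite ler_pM2r ?invr_gt0 // ler_norm.
exists n; rewrite mulrC -ltr_pdivlMr ?exprn_gt0 // mul1r -exprVn.
by apply: lt_le_trans Kn (le_trans _ (bernoulli n)); rewrite lerDr.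
Qed.

(** * Ordered vector spaces *)

Section OrderedSpace.
Context {R : realType} {V : orderedLmodType R}.
Implicit Types (x y z : V) (c : R).

Lemma olmod_subr_ge0 x y : (0 <= y - x) = (x <= y).
Proof.
apply/idP/idP => h.
  by have := @olmod_lerD2r _ _ x _ _ h; rewrite add0r subrK.
by have := @olmod_lerD2r _ _ (- x) _ _ h; rewrite subrr.
Qed.

Lemma olmod_addr_ge0 x y : 0 <= x -> 0 <= y -> 0 <= x + y.
Proof.
move=> x0 y0; apply: le_trans y0 _.
by have := @olmod_lerD2r _ _ y _ _ x0; rewrite add0r.
Qed.

Lemma olmod_scaler_ge0 c x : 0 <= c -> 0 <= x -> 0 <= c *: x.
Proof. by move=> c0 x0; have := olmod_lerZ2l _ _ _ c0 x0; rewrite scaler0. Qed.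

Lemma olmod_lerD x y x' y' : x <= y -> x' <= y' -> x + x' <= y + y'.
Proof.
move=> h h'; rewrite -(olmod_subr_ge0 x) in h.
rewrite -(olmod_subr_ge0 x') in h'.
rewrite -olmod_subr_ge0.
by rewrite opprD addrACA olmod_addr_ge0.
Qed.

End OrderedSpace.

(** * Positive combinations of the operators in S *)

Section Orbit.
Context {R : realType} {V : orderedLmodType R}.
Context {S : set {linear V -> V}} (S_mon : commutative_monoid S)
  (S_pos : forall T, S T -> positive_map T).
Context {v : V} (v_ge0 : 0 <= v).
Implicit Types (T a b : {linear V -> V}) (x y z : V) (c m k : R) (P : set V).

(** The semiring R_+[S], acting on V, together with its augmentation (the sum of
the coefficients).  This is a relation because an operator may have several
expressions, with different sums.  Composition is a constructor although S is
closed under it, so that products of combinations need no distributivity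
argument. *)
Inductive mass : R -> {linear V -> V} -> Prop :=
| mass_in T : S T -> mass 1 T
| mass_scale c m b : 0 <= c -> mass m b -> mass (c * m) (c \*: b)
| mass_add m k a b : mass m a -> mass k b -> mass (m + k) (a \+ b)
| mass_comp m k a b : mass m a -> mass k b -> mass (m * k) (a \o b).

Lemma mass_id : mass 1 idfun.
Proof. by apply: mass_in; case: S_mon. Qed.

(** The zero operator; its mass has the form that the constructor produces. *)
Lemma mass_zero : mass (0 * 1) (0 \*: idfun).
Proof. exact: mass_scale mass_id. Qed.

Lemma mass_ge0 {m b} : mass m b -> 0 <= m.
Proof.
by elim=> // *; rewrite ?mulr_ge0 ?addr_ge0.
Qed.

Lemma mass_commute {m k a b} :
  mass m a -> mass k b -> forall x, a (b x) = b (a x).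
Proof.
have [_ _ comm] := S_mon.
move=> ma mb; elim: ma => {m a} [T ST|c m a _ _ IH|m k' a a' _ IH _ IH'
  |m k' a a' _ IH _ IH'] x /=.
- elim: mb x => {k b} [T' ST'|c k b _ _ IH|m k b b' _ IH _ IH'
    |m k b b' _ IH _ IH'] x /=.
  + exact: comm.
  + by rewrite linearZ /= IH.
  + by rewrite linearD /= IH IH'.
  + by rewrite IH IH'.
- by rewrite IH linearZ.
- by rewrite IH IH' linearD.
- by rewrite IH' IH.
Qed.

(** Bounding f on the whole orbit Sx, and not just at x, makes the estimate
stable under composition. *)
Lemma mass_bound (f : {scalar V}) c x : (forall T, S T -> f (T x) <= c) ->
  forall m b, mass m b -> forall T, S T -> f (T (b x)) <= m * c.
Proof.
have [_ comp _] := S_mon.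
move=> + m b mb; elim: mb c x => {m b} [T ST|d m b d0 _ IH|m k a b _ IH _ IH'
  |m k a b _ IH _ IH'] c x fx T' ST' /=.
- by rewrite mul1r (fx _ (comp _ _ ST' ST)).
- by rewrite !linearZ /= -mulrA ler_wpM2l // IH.
- by rewrite !linearD /= mulrDl lerD ?IH ?IH'.
- by rewrite -mulrA; apply: IH => // T ST; exact: IH'.
Qed.

(** * Admissible cones *)

(** Instead of asking that P contain the positive elements, [coneU] asks that P
be stable under adding them.  The two are equivalent for a nonempty P, but the
empty set satisfies only the latter, as the union of the empty chain must. *)
Record invariant_cone P : Prop := InvariantCone {
  coneD : forall x y, P x -> P y -> P (x + y);
  coneZ : forall c x, 0 <= c -> P x -> P (c *: x);
  cone_map : forall T x, S T -> P x -> P (T x);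
  coneU : forall x y, P x -> 0 <= y -> P (x + y)
}.

Arguments coneD {P} _ {x y}.
Arguments coneZ {P} _ c {x}.
Arguments cone_map {P} _ {T x}.
Arguments coneU {P} _ {x y}.

(** The second clause stands for the existence of a functional f on the orbit
ideal that is nonnegative on P, with f v = 1 and f <= 1 on the orbit: such an f
gives m >= f (b v) >= f v = 1, and Hahn-Banach would give the converse.  Unlike
the existence of f, the clause passes to unions of chains at once. *)
Definition admissible P :=
  invariant_cone P /\ forall m b, mass m b -> P (b v - v) -> 1 <= m.

Lemma cone_le_trans {P x y z} :
  invariant_cone P -> P (y - x) -> P (z - y) -> P (z - x).
Proof. by move=> cP xy yz; rewrite -(subrKA y); apply: coneD. Qed.

Lemma cone_mass {P} : invariant_cone P ->
  forall {m b x}, mass m b -> P x -> P (b x).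
Proof.
move=> cP m b + mb; elim: mb => {m b} [T ST|c m b c0 _ IH|m k a b _ IH _ IH'
  |m k a b _ IH _ IH'] x Px /=.
- exact: cone_map.
- by apply: coneZ => //; exact: IH.
- by apply: coneD; [|exact: IH|exact: IH'].
- by apply: IH; apply: IH'.
Qed.

Lemma mass_positive {m b} : mass m b -> positive_map b.
Proof.
move=> mb x x0; apply: (@cone_mass [set y | 0 <= y]) (mb) x0; split=> /= *.
- exact: olmod_addr_ge0.
- exact: olmod_scaler_ge0.
- exact: S_pos.
- exact: olmod_addr_ge0.
Qed.

(** The explicit form of the orbit ideal.  It is enough that the orbit ideal is
contained in it, since a functional can be restricted. *)
Definition orbit_bounded x := exists m b, [/\ mass m b, x <= b v & - x <= b v].

Lemma orbit_boundedZ c x : orbit_bounded x -> orbit_bounded (c *: x).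
Proof.
move=> [m [b [mb h h']]]; have [c0|/ltW c0] := leP 0 c.
  exists (c * m), (c \*: b); split; first exact: mass_scale.
    exact: olmod_lerZ2l.
  by rewrite -scalerN; exact: olmod_lerZ2l.
have c0' : 0 <= - c by rewrite oppr_ge0.
exists (- c * m), (- c \*: b); split; first exact: mass_scale.
  by rewrite -[X in X *: x]opprK scaleNr -scalerN; exact: olmod_lerZ2l.
by rewrite -scaleNr; exact: olmod_lerZ2l.
Qed.

Lemma orbit_boundedD x y :
  orbit_bounded x -> orbit_bounded y -> orbit_bounded (x + y).
Proof.
move=> [m [b [mb h1 h2]]] [k [a [ka h3 h4]]].
exists (m + k), (b \+ a); split; first exact: mass_add.
  exact: olmod_lerD.
by rewrite opprD; exact: olmod_lerD.
Qed.

Lemma orbit_bounded_map T x : S T -> orbit_bounded x -> orbit_bounded (T x).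
Proof.
move=> ST [m [b [mb h1 h2]]]; exists (1 * m), (T \o b).
split; first by apply: mass_comp mb; exact: mass_in.
- rewrite -olmod_subr_ge0 /= -linearB; apply: S_pos => //.
  by rewrite olmod_subr_ge0.
- rewrite -linearN -olmod_subr_ge0 /= -linearB; apply: S_pos => //.
  by rewrite olmod_subr_ge0.
Qed.

Lemma orbit_bounded_orbit T : S T -> orbit_bounded (T v).
Proof.
move=> ST; exists 1, T; split=> //; first exact: mass_in.
apply: (@le_trans _ _ 0); last exact: S_pos.
by rewrite -olmod_subr_ge0 opprK add0r; exact: S_pos.
Qed.

Lemma orbit_ideal_bounded : orbit_ideal S v `<=` orbit_bounded.
Proof.
apply: smallest_sub; last by move=> _ [T ST <-]; exact: orbit_bounded_orbit.
split.
  split.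
    rewrite inE; exists (0 * 1), (0 \*: idfun).
    by split; rewrite /= ?scale0r ?oppr0 //; exact: mass_zero.
  move=> c x y; rewrite !inE => hx hy.
  by apply: orbit_boundedD => //; exact: orbit_boundedZ.
move=> x y z [m [b [mb _ h1]]] [k [a [ka h2 _]]] xy yz.
have bv0 : 0 <= b v by exact: (mass_positive mb).
have av0 : 0 <= a v by exact: (mass_positive ka).
exists (m + k), (b \+ a); split; first exact: mass_add.
  by apply: le_trans yz (le_trans h2 _); rewrite -olmod_subr_ge0 /= addrK.
apply: (@le_trans _ _ (- x)).
  by rewrite -olmod_subr_ge0 opprK addrC olmod_subr_ge0.
by apply: le_trans h1 _; rewrite -olmod_subr_ge0 /= addrC addKr.
Qed.

(** Let s = sup f(Sv) > 0.  If v <= b v with b of mass m, then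
f (T v) <= f (T (b v)) <= m s for every T in S, so s <= m s. *)
Lemma positive_cone_admissible (f : {scalar V}) :
  positive_on setT f -> f v != 0 -> has_ubound (operator_orbit S v) ->
  admissible [set x | 0 <= x].
Proof.
move=> fpos fv [w vw]; split.
  split=> /= *.
  - exact: olmod_addr_ge0.
  - exact: olmod_scaler_ge0.
  - exact: S_pos.
  - exact: olmod_addr_ge0.
have [Sid _ _] := S_mon.
have f_le x y : x <= y -> f x <= f y.
  by rewrite -olmod_subr_ge0 -subr_ge0 -linearB; exact: fpos.
have fv0 : 0 < f v by rewrite lt_neqAle eq_sym fv fpos.
move=> m b mb /= bv; rewrite leNgt; apply/negP => m1.
pose A := [set f (T v) | T in S].
have supA : has_sup A.
  split; first by exists (f v), idfun.
  by exists (f w) => _ [T ST <-]; apply: f_le; apply: vw; exists T.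
have fA T : S T -> f (T v) <= sup A.
  by move=> ST; apply: ub_le_sup; [case: supA|exists T].
have sup0 : 0 < sup A by apply: lt_le_trans fv0 (fA idfun Sid).
suff : sup A <= m * sup A by rewrite ler_pMl // leNgt m1.
apply: ge_sup; first by case: supA.
move=> _ [T ST <-]; apply: le_trans (mass_bound _ _ _ fA _ _ mb _ ST).
by apply: f_le; rewrite -olmod_subr_ge0 -linearB; exact: S_pos.
Qed.

(** * Maximal admissible cones *)

Lemma exists_maximal : admissible [set x | 0 <= x] ->
  exists P, [/\ admissible P, [set x | 0 <= x] `<=` P
    & forall Q, P `<=` Q -> admissible Q -> Q `<=` P].
Proof.
move=> adm0.
have [P [admP maxP]] :
    exists P, admissible P /\ forall Q, P `<` Q -> ~ admissible Q.
  apply: Zorn_bigcup => F Fadm Ftot; split; first split.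
  - move=> x y [A FA Ax] [B FB By].
    have [AB|BA] := Ftot _ _ FA FB.
      by exists B => //; apply: (coneD (Fadm _ FB).1) => //; exact: AB.
    by exists A => //; apply: (coneD (Fadm _ FA).1) => //; exact: BA.
  - by move=> c x c0 [A FA Ax]; exists A => //; apply: (coneZ (Fadm _ FA).1).
  - by move=> T x ST [A FA Ax]; exists A => //; apply: (cone_map (Fadm _ FA).1).
  - by move=> x y [A FA Ax] y0; exists A => //; apply: (coneU (Fadm _ FA).1).
  - by move=> m b mb [A FA Ab]; exact: (Fadm _ FA).2 mb Ab.
have max Q : P `<=` Q -> admissible Q -> Q `<=` P.
  by move=> PQ admQ; apply: contrapT => nQP; exact: maxP admQ.
exists P; split=> //.
(* Zorn's lemma alone could return the empty cone; it is not maximal, since the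
cone of positive elements contains it. *)
have [P0|] := pselect (P 0).
  by move=> x x0; rewrite -[x]add0r; apply: (coneU admP.1).
move=> nP0; exfalso; apply: (nP0); apply: (max _ _ adm0) => //=.
move=> x Px; exfalso; apply: nP0.
by rewrite -(scale0r x); apply: (coneZ admP.1).
Qed.

Section MaximalCone.
Context {P : set V} (admP : admissible P) (posP : [set x | 0 <= x] `<=` P)
  (maxP : forall Q, P `<=` Q -> admissible Q -> Q `<=` P).

Let cP : invariant_cone P := admP.1.

Let P0 : P 0. Proof. by apply: posP => /=. Qed.

Let Pv : P v. Proof. exact: posP. Qed.

(** Otherwise v <=_P 0, although the zero operator has mass 0 < 1. *)
Lemma scale_unit_ge0 c : P (c *: v) -> 0 <= c.
Proof.
move=> Pc; rewrite leNgt; apply/negP => c0.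
have := admP.2 _ _ mass_zero.
rewrite /= scale0r sub0r mul0r ler10; move/(_ _)/negP; apply=> //.
have -> : - v = (- c)^-1 *: (c *: v).
  by rewrite scalerA invrN mulNr mulVf ?lt_eqF // scaleN1r.
by apply: coneZ Pc; rewrite // invr_ge0 oppr_ge0 ltW.
Qed.

(** If y is not in P, the invariant cone P + R_+[S] y is strictly larger than P,
so it violates the condition on masses. *)
Lemma maximal_exclusion y : ~ P y -> exists m b k a,
  [/\ mass m b, mass k a, m < 1 & P (b v - v - a y)].
Proof.
move=> nPy; apply: contrapT => nex; apply: nPy.
pose Q := [set x | exists k a, mass k a /\ P (x - a y)].
have PQ : P `<=` Q.
  move=> x Px; exists (0 * 1), (0 \*: idfun); split; first exact: mass_zero.
  by rewrite /= scale0r subr0.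
apply: (maxP _ PQ); last first.
  by exists 1, idfun; split; [exact: mass_id|rewrite /= subrr].
split; first split.
- move=> x x' [k [a [ka Px]]] [k' [a' [ka' Px']]].
  exists (k + k'), (a \+ a'); split; first exact: mass_add.
  by rewrite /= opprD addrACA; apply: coneD.
- move=> c x c0 [k [a [ka Px]]].
  exists (c * k), (c \*: a); split; first exact: mass_scale.
  by rewrite /= -scalerBr; apply: coneZ.
- move=> T x ST [k [a [ka Px]]].
  exists (1 * k), (T \o a); split.
    by apply: mass_comp => //; exact: mass_in.
  by rewrite /= -linearB; apply: cone_map.
- move=> x z [k [a [ka Px]]] z0; exists k, a; split => //.
  by rewrite addrAC; apply: coneU.
- move=> m b mb [k [a [ka Pb]]]; rewrite leNgt; apply/negP => m1.
  by apply: nex; exists m, b, k, a.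
Qed.

(** Iterating b gives v <=_P b^n (a v), an operator of mass m^n k, which drops
below 1. *)
Lemma no_contraction m b k a : mass m b -> mass k a -> m < 1 ->
  P (a v - v) -> P (b (a v) - a v) -> False.
Proof.
move=> mb ka m1 va abv.
have iter n :
    exists e, [/\ mass (m ^+ n * k) e, P (e v - v) & P (b (e v) - e v)].
  elim: n => [|n [e [me ve eb]]]; first by exists a; rewrite expr0 mul1r.
  exists (b \o e); rewrite exprS -mulrA; split=> /=.
  - exact: mass_comp.
  - exact: cone_le_trans ve eb.
  - by rewrite -linearB; exact: (cone_mass cP mb).
have [n nk] := exists_expr_lt1 _ _ k (mass_ge0 mb) m1.
have [e [me ve _]] := iter n.
by have := admP.2 _ _ me ve; rewrite leNgt nk.
Qed.

(** With a = sum_(i <= n) c^(n-i) T^i and w = T^(n+1), the equation is the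
telescoping identity a (T - c) = T^(n+1) - c^(n+1), written without
subtraction. *)
Lemma truncated_resolvent T c : S T -> 0 <= c -> forall n, exists k a w,
  [/\ mass k a, mass 1 w,
      forall x, a (T x) + c ^+ n.+1 *: x = c *: a x + w x
    & forall x, P x -> P (a x - c ^+ n *: x)].
Proof.
move=> ST c0; elim=> [|n [k [a [w [ka mw aT aP]]]]].
  exists 1, idfun, T; split => [|||x Px /=]; [exact: mass_id|exact: mass_in| |].
    by move=> x /=; rewrite expr1 addrC.
  by rewrite expr0 scale1r subrr.
have mT : mass 1 T by exact: mass_in.
have mc : mass (c ^+ n.+1 * 1) (c ^+ n.+1 \*: idfun).
  by apply: mass_scale mass_id; rewrite exprn_ge0.
exists (k * 1 + c ^+ n.+1 * 1), (a \o T \+ c ^+ n.+1 \*: idfun), (w \o T).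
split=> [|||x Px /=].
- by apply: mass_add mc; exact: mass_comp.
- by rewrite -(mulr1 1); exact: mass_comp.
- move=> x /=; rewrite aT scalerDr scalerA -exprS.
  by rewrite addrAC.
- rewrite addrK.
  exact: (cone_mass cP ka) (cone_map cP ST Px).
Qed.

(** If p - T p is not in P, a combination b of mass m < 1 satisfies
v + q <=_P b v + T q, where q = a p is in P and dominated by e v with e of
mass C.  The operator A below is r^n times a partial sum of the Neumann series
in T / r, for some r > 1; it satisfies r^n v <=_P A v.  Applying
A to the inequality and using A T = r A + w - r^(n+1) gives
A v <=_P b (A v) + (r - 1) A q + w q, hence
A v <=_P (b + (r - 1) e + r^(-n) w e) (A v).  For r close to 1 and then n large
the operator on the right has mass below 1. *)
Lemma maximal_excessive T p : S T -> P p -> orbit_bounded p -> P (p - T p).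
Proof.
move=> ST Pp [k [d [kd pd _]]]; apply: contrapT => /maximal_exclusion.
move=> [m [b [l [a [mb la m1 Pb]]]]].
pose q := a p; pose C := l * k.
have Pq : P q by exact: (cone_mass cP la).
have [e [mC qe]] : exists e, mass C e /\ P (e v - q).
  exists (a \o d); split; first exact: mass_comp.
  rewrite /q /= -linearB; apply: (cone_mass cP la).
  by apply: posP; rewrite /= olmod_subr_ge0.
have Tq : P (b v + T q - (v + q)).
  have -> // : b v + T q - (v + q) = b v - v - a (p - T p).
  rewrite linearB /= -/q (mass_commute la (mass_in _ ST)) -/q.
  by rewrite opprD addrACA opprB.
have C0 : 0 <= C by exact: mass_ge0 mC.
(* The gap 1 - m is split in three: eps C < dl and r^(-n) C < dl leave a total
mass below m + 2 dl < 1. *)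
pose dl := (1 - m) / 3.
have dl0 : 0 < dl by rewrite /dl; lra.
pose eps := dl / (C + 1).
have eps0 : 0 < eps by rewrite divr_gt0 //; lra.
have epsC : eps * C < dl.
  by rewrite /eps -mulrA gtr_pMr // mulrC ltr_pdivrMr; lra.
pose r := 1 + eps.
have r1 : 1 < r by rewrite ltrDl.
have r0 : 0 < r by rewrite (lt_trans ltr01).
have [n nC] : exists n, r^-1 ^+ n * (C / dl) < 1.
  by apply: exists_expr_lt1; [rewrite invr_ge0 ltW|rewrite invf_lt1].
have {}nC : r^-1 ^+ n * C < dl by rewrite mulrA ltr_pdivrMr // mul1r in nC.
have [kR [A [w [mA mw AT AP]]]] := truncated_resolvent T r ST (ltW r0) n.
pose B : {linear V -> V} := b \+ (eps \*: e \+ r^-1 ^+ n \*: (w \o e)).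
have rn0 : 0 <= r^-1 ^+ n by rewrite exprn_ge0 // invr_ge0 ltW.
have vA : P (r^-1 ^+ n *: A v - v).
  have -> : r^-1 ^+ n *: A v - v = r^-1 ^+ n *: (A v - r ^+ n *: v).
    by rewrite scalerBr scalerA -exprMn mulVf ?gt_eqF // expr1n scale1r.
  by apply: coneZ => //; exact: AP.
have mB : mass (m + (eps * C + r^-1 ^+ n * (1 * C))) B.
  apply: mass_add => //; apply: mass_add; apply: mass_scale => //.
    exact: ltW.
  exact: mass_comp.
have mB1 : m + (eps * C + r^-1 ^+ n * (1 * C)) < 1.
  by rewrite mul1r /dl in nC epsC *; lra.
apply: (no_contraction _ _ _ _ mB mA mB1).
  apply: cone_le_trans cP _ (AP v Pv).
  have -> : r ^+ n *: v - v = (r ^+ n - 1) *: v by rewrite scalerBl scale1r.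
  by apply: coneZ => //; rewrite subr_ge0 exprn_ege1 // ltW.
(* Adding r^(n+1) q, which is in P, to the right-hand side lets the telescoping
identity absorb it. *)
have s1 : P (b (A v) + (eps *: A q + w q) - A v).
  have : P (A (b v + T q - (v + q)) + r ^+ n.+1 *: q).
    apply: coneD => //; first exact: (cone_mass cP mA).
    by apply: coneZ => //; rewrite exprn_ge0 // ltW.
  rewrite linearB !linearD /= addrAC -(addrA _ (A (T q))) AT.
  rewrite {1}/r scalerDl scale1r (mass_commute mA mb).
  rewrite -(addrA (A q)) (addrCA _ (A q)) (addrC (A q)) (addrC (- A v)).
  by rewrite (addrA _ (- A q)) addrK.
apply: cone_le_trans cP s1 _.
rewrite /B /= [X in P X](_ : _ =
  eps *: (e (A v) - A q) + (r^-1 ^+ n *: w (e (A v)) - w q)).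
  apply: coneD => //.
    apply: coneZ => //; first exact: ltW.
    rewrite (mass_commute mC mA) -linearB.
    exact: (cone_mass cP mA).
  rewrite -linearZ -linearB /=; apply: (cone_mass cP mw).
  apply: cone_le_trans cP qe _.
  by rewrite -linearZ -linearB; exact: (cone_mass cP mC vA).
by rewrite opprD addrACA subrr add0r scalerBr opprD addrACA.
Qed.

(** * The order unit and totality *)

Lemma unit_dominates_mass m b : mass m b -> P (m *: v - b v).
Proof.
elim=> {m b} [T ST|c m b c0 _ IH|m k a b _ IH _ IH'|m k a b ma IH mb IH'] /=.
- rewrite scale1r; apply: maximal_excessive => //.
  by have [Sid _ _] := S_mon; exact: (orbit_bounded_orbit idfun).
- by rewrite -scalerA -scalerBr; exact: coneZ.
- by rewrite scalerDl opprD addrACA; exact: coneD.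
- apply: (@cone_le_trans P _ (a (k *: v))) => //.
    by rewrite -linearB; exact: (cone_mass cP ma).
  rewrite linearZ /= mulrC -scalerA -scalerBr.
  by apply: coneZ => //; exact: mass_ge0 mb.
Qed.

Lemma unit_dominates x : orbit_bounded x ->
  exists c, [/\ 0 <= c, P (c *: v - x) & P (c *: v + x)].
Proof.
move=> [m [b [mb h1 h2]]]; exists m; split; first exact: mass_ge0 mb.
  apply: (@cone_le_trans P _ (b v)) (unit_dominates_mass _ _ mb) => //.
  by apply: posP; rewrite /= olmod_subr_ge0.
rewrite -[x]opprK.
apply: (@cone_le_trans P _ (b v)) (unit_dominates_mass _ _ mb) => //.
by apply: posP; rewrite /= olmod_subr_ge0.
Qed.

(** If P excludes both x and - x, then a x <=_P - (1 - m) v and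
(1 - m') v <=_P a' x.  Applying a' to the former and a to the latter bounds
a' (a x) = a (a' x) from both sides, which leaves a v <=_P 0.  With - c v <=_P x
this gives 0 <=_P a x, against a x <=_P - (1 - m) v. *)
Lemma maximal_total x : orbit_bounded x -> P x \/ P (- x).
Proof.
move=> xb; have [Px|nPx] := pselect (P x); first by left.
have [Px|nPNx] := pselect (P (- x)); first by right.
exfalso.
have [m [b [k [a [mb ka m1 H1]]]]] := maximal_exclusion _ nPx.
have [m' [b' [k' [a' [mb' ka' m1' H2]]]]] := maximal_exclusion _ nPNx.
have dom m0 b0 z : mass m0 b0 -> P (b0 v - v - z) -> P (- (1 - m0) *: v - z).
  move=> mb0 h; have := coneD cP (unit_dominates_mass _ _ mb0) h.
  by rewrite !addrA subrK opprB scalerBl scale1r.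
have {}H1 := dom _ _ _ mb H1; have {}H2 := dom _ _ _ mb' H2.
have [c [c0 _ cx]] := unit_dominates _ xb.
have av : P (- a v).
  have h1 := cone_mass cP ka' H1; have h2 := cone_mass cP ka H2.
  have h3 : P ((1 - m) *: a' v).
    by apply: coneZ; rewrite ?subr_ge0 ?ltW //; exact: (cone_mass cP ka').
  have := coneD cP (coneD cP h1 h2) h3.
  rewrite !linearB !linearZ /= !linearN opprK (mass_commute ka ka').
  rewrite (addrC (- (1 - m') *: _)) addrA subrK addrAC scaleNr addNr add0r.
  rewrite scaleNr -scalerN => h.
  have m'0 : 0 <= (1 - m')^-1 by rewrite invr_ge0 subr_ge0 ltW.
  have := coneZ cP _ m'0 h.
  by rewrite scalerA mulVf ?gt_eqF ?subr_gt0 // scale1r.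
have h1 := cone_mass cP ka cx.
have := coneD cP (coneD cP H1 h1) (coneZ cP c c0 av).
rewrite linearD linearZ /= (addrC (c *: _)) addrA subrK scalerN addrK.
by move/scale_unit_ge0; rewrite oppr_ge0 subr_le0 leNgt m1.
Qed.

(** * The eigenfunctional *)

(** The infinitesimals for the order unit v form an S-stable subspace, and each
vector of the orbit ideal is congruent, modulo this subspace, to exactly one
multiple of v. *)
Definition infinitesimal x :=
  forall c, 0 < c -> P (c *: v - x) /\ P (c *: v + x).

Lemma infinitesimalD x y :
  infinitesimal x -> infinitesimal y -> infinitesimal (x + y).
Proof.
move=> ix iy c c0.
have c2 : 0 < c / 2 by lra.
have [h1 h2] := ix _ c2; have [h3 h4] := iy _ c2.
rewrite [c](_ : c = c / 2 + c / 2); last by field.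
rewrite scalerDl opprD !(addrACA (_ *: v) (_ *: v)).
by split; exact: coneD.
Qed.

Lemma infinitesimalN x : infinitesimal x -> infinitesimal (- x).
Proof. by move=> ix c c0; have [? ?] := ix c c0; rewrite opprK. Qed.

Lemma infinitesimalZ c x : infinitesimal x -> infinitesimal (c *: x).
Proof.
have pos (d : R) z : 0 < d -> infinitesimal z -> infinitesimal (d *: z).
  move=> d0 iz e e0.
  have de0 : 0 < d^-1 * e by rewrite mulr_gt0 ?invr_gt0.
  have [h1 h2] := iz _ de0; have := coneZ cP d (ltW d0) h1.
  have := coneZ cP d (ltW d0) h2.
  by rewrite scalerBr scalerDr scalerA mulVKf ?gt_eqF.
move=> ix; case: (ltgtP c 0) => [c0|c0|->].
- rewrite -[c]opprK scaleNr; apply: infinitesimalN; apply: pos => //.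
  by rewrite oppr_gt0.
- exact: pos.
- rewrite scale0r => d d0; rewrite subr0 addr0.
  by split; apply: coneZ => //; exact: ltW.
Qed.

(** T v <=_P v keeps the bounds -c v <=_P x <=_P c v when T is applied. *)
Lemma infinitesimal_map T x : S T -> infinitesimal x -> infinitesimal (T x).
Proof.
move=> ST ix c c0; have [h1 h2] := ix c c0.
have vT : P (c *: v - T (c *: v)).
  rewrite linearZ -scalerBr; apply: coneZ; rewrite ?ltW //.
  have := unit_dominates_mass _ _ (mass_in _ ST).
  by rewrite scale1r.
split; first by apply: cone_le_trans cP _ vT; rewrite -linearB; exact: cone_map.
rewrite -[T x]opprK; apply: cone_le_trans cP _ vT.
by rewrite opprK -linearD; exact: cone_map.
Qed.

Lemma value_ge0 x c : P x -> infinitesimal (x - c *: v) -> 0 <= c.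
Proof.
move=> Px ix; rewrite leNgt; apply/negP => c0.
have [|h _] := ix (- c / 2); first by lra.
have := coneD cP h Px; rewrite opprB addrA subrK -scalerDl.
by move/scale_unit_ge0; lra.
Qed.

Lemma value_unique x c d :
  infinitesimal (x - c *: v) -> infinitesimal (x - d *: v) -> c = d.
Proof.
move=> ic ix; have := infinitesimalD _ _ ic (infinitesimalN _ ix).
rewrite opprB addrC addrA subrK -scalerBl => h.
apply: le_anti; rewrite -(subr_ge0 c) -(subr_ge0 d); apply/andP; split.
  by apply: (value_ge0 0) => //; rewrite sub0r; exact: infinitesimalN.
by apply: (value_ge0 0) => //; rewrite sub0r -scaleNr opprB.
Qed.

(** The supremum of the c with c v <=_P x; totality makes it an infimum of upper
bounds too. *)
Lemma exists_value x : orbit_bounded x -> exists c, infinitesimal (x - c *: v).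
Proof.
move=> xb; have [M [M0 Mx Mx']] := unit_dominates _ xb.
pose A := [set c | P (x - c *: v)].
have supA : has_sup A.
  split; first by exists (- M); rewrite /A /= scaleNr opprK addrC.
  exists M => c /= Ac; rewrite -subr_ge0; apply: scale_unit_ge0.
  by have := coneD cP Mx Ac; rewrite addrA subrK scalerBl.
exists (sup A) => e e0; split.
  have [h|h] : P (x - (sup A + e) *: v) \/ P (- (x - (sup A + e) *: v)).
  - apply: maximal_total; apply: orbit_boundedD => //; rewrite -scaleNr.
    by apply: orbit_boundedZ; apply: (orbit_bounded_orbit idfun); case: S_mon.
  - have : sup A + e <= sup A by apply: ub_le_sup => //; case: supA.
    by rewrite leNgt ltrDl e0.
  - by move: h; rewrite !opprB scalerDl addrA (addrC (e *: v)).
have [c Ac ec] := sup_adherent e0 supA.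
have h : P ((c - (sup A - e)) *: v) by apply: coneZ; rewrite ?subr_ge0 ?ltW.
have := coneD cP Ac h.
by rewrite scalerBl addrA subrK scalerBl opprB addrCA.
Qed.

(** Each identity for J follows from [value_unique]: both sides are values of
one vector.  For J (T x), the vector T x - J x *: T v is infinitesimal as the
image of x - J x *: v, and T v is infinitesimally close to J (T v) *: v. *)
Lemma maximal_eigenfunctional : exists J : V -> R,
  [/\ linear_on orbit_bounded J, positive_on orbit_bounded J, J v = 1,
      forall T, S T -> 0 <= J (T v) <= 1
    & forall T x, S T -> orbit_bounded x -> J (T x) = J (T v) * J x].
Proof.
have bv : orbit_bounded v.
  by apply: (orbit_bounded_orbit idfun); case: S_mon.
pose J x := xget 0 [set c | infinitesimal (x - c *: v)].
have JP x : orbit_bounded x -> infinitesimal (x - J x *: v).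
  by move=> /exists_value; exact: xgetPex.
have infT T : S T -> infinitesimal (T v - J (T v) *: v).
  by move=> ST; apply: JP; exact: orbit_bounded_orbit.
exists J; split.
- move=> c x y bx y_bd; apply: (value_unique (c *: x + y)).
    by apply: JP; apply: orbit_boundedD => //; exact: orbit_boundedZ.
  have := infinitesimalD _ _ (infinitesimalZ c _ (JP x bx)) (JP y y_bd).
  by rewrite scalerBr scalerA addrACA -opprD -scalerDl.
- move=> x bx x0; apply: value_ge0 (JP x bx).
  exact: posP.
- apply: value_unique (JP v bv) _; rewrite scale1r subrr => c c0.
  by rewrite subr0 addr0; split; apply: (coneZ cP); rewrite // ltW.
- move=> T ST; apply/andP; split.
    by apply: value_ge0 (infT T ST); exact: (cone_map cP).
  rewrite -subr_ge0; apply: (value_ge0 (v - T v)).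
    exact: maximal_excessive.
  have := infinitesimalN _ (infT T ST).
  rewrite opprB scalerBl scale1r opprB.
  by rewrite [X in _ -> infinitesimal X]addrC subrKA.
- move=> T x ST bx; apply: (value_unique (T x)).
    by apply: JP; exact: orbit_bounded_map.
  have := infinitesimalD _ _ (infinitesimal_map _ _ ST (JP x bx))
                             (infinitesimalZ (J x) _ (infT T ST)).
  by rewrite linearB linearZ scalerBr addrA subrK scalerA mulrC.
Qed.

End MaximalCone.
End Orbit.

Theorem theorem2 (R : realType) (V : orderedLmodType R)
  (S : set {linear V -> V}) :
  non_singular V ->
  commutative_monoid S ->
  (forall T, S T -> positive_map T) ->
  forall v : V, 0 <= v -> v != 0 ->
  has_ubound (operator_orbit S v) ->
  exists (J : V -> R) (t : {linear V -> V} -> R),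
    [/\ linear_on (orbit_ideal S v) J,
        positive_on (orbit_ideal S v) J,
        unit_interval_morphism S t,
        forall T, S T -> forall u, orbit_ideal S v u -> J (T u) = t T * J u
      & J v = 1].
Proof.
move=> nsV S_mon S_pos v v0 vn0 bounded.
have [f [fpos fv]] := nsV v v0 vn0.
have adm0 := positive_cone_admissible S_mon S_pos v0 f fpos fv bounded.
have [P [admP posP maxP]] := exists_maximal adm0.
have [J [Jlin Jpos Jv J01 Jeig]] :=
  maximal_eigenfunctional S_mon S_pos v0 admP posP maxP.
have bnd := orbit_ideal_bounded S_mon S_pos v0.
exists J, (fun T => J (T v)); split=> //.
- by move=> a x y /bnd bx /bnd y_bd; exact: Jlin.
- by move=> x /bnd; exact: Jpos.
- split=> // T1 T2 ST1 ST2; rewrite /= Jeig //.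
  exact: orbit_bounded_orbit.
- by move=> T ST x /bnd; exact: Jeig.
Qed.
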